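(* Let $G$ be a group and let $\sigma_G$ be a spectrum of $G$ that contains the trivial subgroup $\mathfrak{e}$ of $G$. Then $\sigma_G$, endowed with the coarse lower topology, is connected.
   Context: For a group $G$, $\mathrm{N}_G$ denotes the set of all normal subgroups of $G$, and $\mathfrak{e}$ the trivial subgroup. A spectrum $\sigma_G$ of $G$ is the set of all normal subgroups of $G$ having some fixed property (e.g. being prime, maximal, primary, principal, finitely generated, proper, ...), with the standing assumption $G\notin\sigma_G$; so it is a set of proper normal subgroups of $G$. For $\mathfrak{x}\in \mathrm{N}_G$ put $\mathcal{V}(\mathfrak{x})=\{\mathfrak{n}\in\sigma_G\mid \mathfrak{x}\subseteq\mathfrak{n}\}$. The coarse lower topology on $\sigma_G$ is the topology for which the sets $\mathcal{V}(\mathfrak{x})$, $\mathfrak{x}\in \mathrm{N}_G$, form a subbasis of closed sets. A spectrum with this topology is called a normal structure space. *)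

(* Defs.v *)
From HB Require Import structures.
From mathcomp Require Import all_boot.
From mathcomp Require Import boolp classical_sets topology.

Set Implicit Arguments.
Unset Strict Implicit.
Unset Printing Implicit Defensive.

Local Open Scope classical_set_scope.
Local Open Scope group_scope.

Record normal_subgroup (G : groupType) := NormalSubgroup {
  normal_carrier : set G;
  normal_group_closed : group_closed [in normal_carrier];
  normal_conjg_closed : forall x y : G, normal_carrier x -> normal_carrier (x ^ y)
}.

Section NormalSubgroups.
Variable G : groupType.

Lemma trivial_group_closed : group_closed [in [set 1 : G]].
Proof.
split; first by rewrite inE.
by move=> x y; rewrite !inE /= => -> ->; rewrite mulgV.
Qed.

Lemma trivial_conjg_closed (x y : G) : [set 1 : G] x -> [set 1 : G] (x ^ y).
Proof. by move=> /= ->; rewrite conj1g. Qed.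

Definition trivial_normal : normal_subgroup G :=
  NormalSubgroup trivial_group_closed trivial_conjg_closed.

Lemma whole_group_closed : group_closed [in [set: G]].
Proof. by split=> [|x y _ _]; rewrite inE. Qed.

Definition whole_normal : normal_subgroup G :=
  NormalSubgroup whole_group_closed (fun _ _ _ => I).

HB.instance Definition _ := gen_eqMixin (normal_subgroup G).
HB.instance Definition _ := gen_choiceMixin (normal_subgroup G).
HB.instance Definition _ := isPointed.Build (normal_subgroup G) trivial_normal.

End NormalSubgroups.

(* The property defining a spectrum is arbitrary, so a spectrum is any set of
   normal subgroups that does not contain the whole group. *)
Record spectrum (G : groupType) := Spectrum {
  spectrum_set : set (normal_subgroup G);
  spectrum_proper : ~ spectrum_set (whole_normal G)
}.

Definition normal_structure_space (G : groupType) (sigma : spectrum G) : Type :=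
  {n : normal_subgroup G | n \in spectrum_set sigma}.

Section CoarseLowerTopology.
Variables (G : groupType) (sigma : spectrum G).

Definition hull (x : normal_subgroup G) : set (normal_structure_space sigma) :=
  [set n | normal_carrier x `<=` normal_carrier (sval n)].

HB.instance Definition _ := gen_eqMixin (normal_structure_space sigma).
HB.instance Definition _ := gen_choiceMixin (normal_structure_space sigma).

(* Coarse lower topology: the complements of the hulls form an open subbase. *)
HB.instance Definition _ :=
  isSubBaseTopological.Build (normal_structure_space sigma)
    [set: normal_subgroup G] (fun x => ~` hull x).

End CoarseLowerTopology.

(* Main.v *)
Require Import Defs.
From mathcomp Require Import all_boot.
From mathcomp Require Import boolp classical_sets topology.

Local Open Scope classical_set_scope.

(** The trivial subgroup is a generic point. The closed sets of the coarse
    lower topology are upward closed for inclusion of normal subgroups, since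
    the subbasic ones [hull x] are. Hence the closure of a point contains every
    member of the spectrum lying above it ([hull_sub_closure1]); the trivial
    subgroup lies below all members, so its closure is the whole space. The
    closure of a connected set, here of a point, is connected. *)

(** Each subbasic open set [~` hull x] is downward closed: if [x] is contained
    in [m] and [m] in [n], then [x] is contained in [n]. Finite intersections
    and arbitrary unions preserve this. *)
Lemma open_downward_closed {G : groupType} {sigma : spectrum G}
    (U : set (normal_structure_space sigma)) (m n : normal_structure_space sigma) :
  open U -> normal_carrier (sval m) `<=` normal_carrier (sval n) ->
  U n -> U m.
Proof.
(* The topology is generated from its subbase, so an open set is literally a
   union of finite intersections of subbasic sets. *)
move=> [D' D'fin <-] mn [A D'A An]; exists A => //.
suff Amn : A n -> A m by exact: Amn.
have [F _ <-] := D'fin _ D'A => Fn x Fx xm.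
exact: Fn Fx (subset_trans xm mn).
Qed.

Lemma hull_sub_closure1 {G : groupType} {sigma : spectrum G}
    (m : normal_structure_space sigma) :
  hull (sval m) `<=` closure [set m].
Proof.
move=> n mn U /=; rewrite nbhsE => -[V [oV Vn] VU].
by exists m; split=> //; apply: VU; exact: open_downward_closed oV mn Vn.
Qed.

Theorem theorem3p13 (G : groupType) (sigma : spectrum G)
    (sigma_trivial : spectrum_set sigma (trivial_normal G)) :
  connected [set: normal_structure_space sigma].
Proof.
pose e : normal_structure_space sigma :=
  exist _ (trivial_normal G) (mem_set sigma_trivial).
suff <- : closure [set e] = setT by apply: connected_closure; exact: connected1.
rewrite -subTset => n _; apply: hull_sub_closure1 => _ ->.
by have [n1 _] := normal_group_closed (sval n); rewrite inE in n1.
Qed.
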